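(* Let $K$ be an algebraically closed field and $x$ an indeterminate over $K$. Then every maximal subring of $K[x]$ which contains $K$ is isomorphic to $K+x(x-1)K[x]$ or to $K+x^2K[x]$.
   Context: All rings are commutative with $1\neq 0$; subrings and homomorphisms are unital. A proper subring $S$ of a ring $R$ is a maximal subring of $R$ if it is maximal with respect to inclusion among the proper subrings of $R$. Isomorphic means isomorphic as rings. For $f\in K[x]$, $K+fK[x]=\{a+fg \mid a\in K,\ g\in K[x]\}$. *)

(* Defs.v *)
From HB Require Import structures.
From mathcomp Require Import all_boot all_order all_algebra.
From mathcomp Require Import boolp.

Set Implicit Arguments.
Unset Strict Implicit.
Unset Printing Implicit Defensive.

Import GRing.Theory.
Local Open Scope ring_scope.

(* Subrings of R are MathComp's bundled unital [subringClosed R] predicates.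
   They are boolean-valued; as boolp makes every proposition reflectable by a
   boolean, quantifying over them does range over all subrings of R. *)
Definition proper_subring (R : comNzRingType) (S : subringClosed R) : Prop :=
  exists x : R, x \notin S.

Definition maximal_subring (R : comNzRingType) (S : subringClosed R) : Prop :=
  proper_subring S /\
  forall T : subringClosed R,
    proper_subring T -> {subset S <= T} -> T =i S.

(* A subring regarded as a ring in its own right. *)
Inductive subring_of (R : comNzRingType) (S : subringClosed R) : predArgType :=
  Subring x & x \in S.

Definition subring_val (R : comNzRingType) (S : subringClosed R)
  (u : subring_of S) : R := let: Subring x _ := u in x.

HB.instance Definition _ (R : comNzRingType) (S : subringClosed R) :=
  [isSub for @subring_val R S].
HB.instance Definition _ (R : comNzRingType) (S : subringClosed R) :=
  [Choice of subring_of S by <:].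
HB.instance Definition _ (R : comNzRingType) (S : subringClosed R) :=
  [SubChoice_isSubComNzRing of subring_of S by <:].

Definition ring_isomorphic (A B : nzRingType) : Prop :=
  exists f : {rmorphism A -> B}, bijective f.

Definition const_plus_ideal (K : fieldType) (f : {poly K}) : {pred {poly K}} :=
  fun p => `[< exists (a : K) (g : {poly K}), p = a%:P + f * g >].

Lemma const_plus_ideal_subring (K : fieldType) (f : {poly K}) :
  subring_closed (const_plus_ideal f).
Proof.
split.
- by apply/asboolP; exists 1, 0; rewrite mulr0 addr0.
- move=> p q /asboolP[a [g ->]] /asboolP[b [h ->]]; apply/asboolP.
  by exists (a - b), (g - h); rewrite polyCB mulrBr opprD addrACA.
- move=> p q /asboolP[a [g ->]] /asboolP[b [h ->]]; apply/asboolP.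
  exists (a * b), (a%:P * h + g * b%:P + g * (f * h)).
  by rewrite polyCM mulrDl !mulrDr !mulrA [f * a%:P]mulrC !addrA.
Qed.

HB.instance Definition _ (K : fieldType) (f : {poly K}) :=
  GRing.isSubringClosed.Build {poly K} (const_plus_ideal f)
    (const_plus_ideal_subring f).

(* Main.v *)
(**
  A subring [S] containing [K] lies in [K + fK[x]] for some [f = (x-a)(x-b)],
  unless for all [a], [b] it contains a polynomial [(x-b)(1 + (x-a)w)].  In the
  latter case [S] is the whole of [K[x]].  Indeed, multiplying such polynomials
  gives, for every product [g] of linear factors and every [a], some [g v] in
  [S] with [v(a) = 1]; one linear factor at a time, this yields
  [S + gK[x] = K[x]] for all [g <> 0].  Moreover [K[x]] is a finite [S]-module,
  as [S] contains a nonconstant [p], so [K[x] = S + pK[x]] and the determinant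
  trick provide a nonzero [d] with [dK[x]] inside [S]; then take [g = d].
  Hence a maximal [S] equals some [K + (x-a)(x-b)K[x]], and an affine change of
  variable normalizes [a] and [b].
*)
From HB Require Import structures.
Require Import Defs.
From mathcomp Require Import all_boot all_order all_algebra.
From mathcomp Require Import boolp.
From mathcomp Require Import ring.

Set Implicit Arguments.
Unset Strict Implicit.
Unset Printing Implicit Defensive.

Import GRing.Theory.
Local Open Scope ring_scope.

Lemma ring_isomorphic_restrict (R : comNzRingType) (S T : subringClosed R)
    (phi psi : {rmorphism R -> R}) :
  cancel phi psi -> cancel psi phi ->
  {homo phi : p / p \in S >-> p \in T} ->
  {homo psi : p / p \in T >-> p \in S} ->
  ring_isomorphic (subring_of S) (subring_of T).
Proof.
move=> phiK psiK phiS psiT.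
pose f (u : subring_of S) : subring_of T := Subring (phiS _ (valP u)).
pose g (v : subring_of T) : subring_of S := Subring (psiT _ (valP v)).
have f_zmod : zmod_morphism f by move=> u v; apply: val_inj; apply: rmorphB.
have f_mon : monoid_morphism f.
  by split=> [|u v]; apply: val_inj; [apply: rmorph1 | apply: rmorphM].
pose fM := GRing.isMonoidMorphism.Build _ _ f f_mon.
pose fA := GRing.isZmodMorphism.Build _ _ f f_zmod.
pose F : {rmorphism subring_of S -> subring_of T} := HB.pack f fA fM.
exists F; exists g => u; apply: val_inj; [exact: phiK | exact: psiK].
Qed.

Lemma const_plus_ideal_comp (K : fieldType) (f f' L p : {poly K}) (k : K) :
  f \Po L = k *: f' -> p \in const_plus_ideal f ->
  p \Po L \in const_plus_ideal f'.
Proof.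
move=> fL /asboolP[a [g ->]]; apply/asboolP; exists a, (k *: (g \Po L)).
by rewrite comp_polyD comp_polyC comp_polyM fL -scalerAr scalerAl.
Qed.

(** The substitutions [L] and [M] are inverse automorphisms of K[x]. They exchange the two subrings,
    since the unit [c ^+ 2] is absorbed by the cofactor. *)
Lemma const_plus_ideal_affine (K : fieldType) (S : subringClosed {poly K})
    (f f' : {poly K}) (a c : K) :
  c != 0 -> S =i const_plus_ideal f ->
  f \Po (c *: 'X + a%:P) = c ^+ 2 *: f' ->
  ring_isomorphic (subring_of S) (subring_of (const_plus_ideal f')).
Proof.
move=> c0 SE fL.
pose L : {poly K} := c *: 'X + a%:P; pose M : {poly K} := c^-1 *: ('X - a%:P).
have LM : L \Po M = 'X.
  by rewrite comp_polyD comp_polyZ comp_polyX comp_polyC scalerA divff //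
             scale1r subrK.
have ML : M \Po L = 'X.
  by rewrite comp_polyZ comp_polyB comp_polyX comp_polyC addrK scalerA mulVf //
             scale1r.
have fM : f' \Po M = (c ^+ 2)^-1 *: f.
  rewrite -[in RHS](comp_polyXr f) -LM comp_polyA fL comp_polyZ.
  by rewrite scalerA mulVf ?scale1r // expf_neq0.
apply: (@ring_isomorphic_restrict _ _ _ (comp_poly L) (comp_poly M)).
- by move=> p; rewrite /= -comp_polyA LM comp_polyXr.
- by move=> p; rewrite /= -comp_polyA ML comp_polyXr.
- by move=> p; rewrite SE; apply: const_plus_ideal_comp fL.
- by move=> p pf'; rewrite SE; apply: const_plus_ideal_comp fM pf'.
Qed.

Lemma polyX_notin_const_plus_ideal (K : fieldType) (f : {poly K}) :
  (2 < size f)%N -> 'X \notin const_plus_ideal f.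
Proof.
move=> f2; apply/asboolP => -[a [g Xfg]].
have E : 'X - a%:P = f * g by rewrite Xfg [a%:P + _]addrC addrK.
have := size_XsubC a; rewrite E; have [->|g0] := eqVneq g 0.
  by rewrite mulr0 size_poly0.
have f0 : f != 0 by rewrite -size_poly_gt0; apply: leq_trans f2.
rewrite size_mul // => sz; move: f2 sz; rewrite -size_poly_gt0 in g0.
by case: (size g) g0 => // n _; rewrite addnS /=; case: (size f) => [|[|[|m]]].
Qed.

Lemma rpred_det (R : comNzRingType) (T : subringClosed R) (n : nat)
    (A : 'M[R]_n) :
  (forall i j, A i j \in T) -> \det A \in T.
Proof.
move=> TA; rewrite /determinant; apply: rpred_sum => s _.
by rewrite rpredMsign rpred_prod.
Qed.

Section Subalgebra.
Variables (K : closedFieldType) (S : subringClosed {poly K}).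
Hypothesis KS : forall a : K, a%:P \in S.

(** Induction on size by division by [p]: the coefficients of the quotient get multiplied by [p],
    which lies in [S], and the remainder has constant coefficients. *)
Lemma poly_powers_span (p : {poly K}) :
  (1 < size p)%N -> p \in S ->
  forall q : {poly K}, exists2 c : 'I_(size p) -> {poly K},
    (forall i, c i \in S) & q = \sum_i c i * 'X^i.
Proof.
move=> p1 pS q; have [n] := ubnP (size q); elim: n q => // n IHn q /ltnSE qn.
have p0 : p != 0 by rewrite -size_poly_gt0 ltnW.
have [->|q0] := eqVneq q 0.
  by exists (fun=> 0) => [i|]; rewrite ?rpred0 // big1 // => i _; rewrite mul0r.
have [|c cS qE] := IHn (q %/ p).
  apply: leq_trans qn; rewrite size_divp //.
  by rewrite -size_poly_gt0 in q0; rewrite ltn_subrL -subn1 subn_gt0 p1.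
exists (fun i => c i * p + ((q %% p)`_i)%:P) => [i|].
  by rewrite rpredD // rpredM.
have rE : q %% p = \sum_(i < size p) ((q %% p)`_i)%:P * 'X^i.
  have /take_poly_id : (size (q %% p)%R <= size p)%N by rewrite ltnW // ltn_modp.
  rewrite /take_poly poly_def => {1}<-.
  by apply: eq_bigr => i _; rewrite mul_polyC.
rewrite {1}(divp_eq q p) {1}qE mulr_suml {1}rE -big_split.
by apply: eq_bigr => i _ /=; rewrite mulrDl mulrAC.
Qed.

Lemma conductor_neq0 (p : {poly K}) :
  (1 < size p)%N -> p \in S ->
  (forall q, exists r, q - p * r \in S) ->
  exists2 d : {poly K}, d != 0 & forall q, d * q \in S.
Proof.
move=> p1 pS Sp; pose n := size p.
pose x : 'cV[{poly K}]_n := \col_(i < n) 'X^i.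
have [r rS] : exists r : 'I_n -> {poly K}, forall i, x i 0 - p * r i \in S.
  by apply: (@fin_all_exists _ _ (fun i r => x i 0 - p * r \in S)) => i; apply: Sp.
have [A AP] : exists A : 'I_n -> 'I_n -> {poly K}, forall i,
    (forall j, A i j \in S) /\ r i = \sum_j A i j * 'X^j.
  apply: (@fin_all_exists _ _ (fun i (c : 'I_n -> {poly K}) =>
    (forall j, c j \in S) /\ r i = \sum_j c j * 'X^j)) => i.
  by have [c cS rE] := poly_powers_span p1 pS (r i); exists c.
(* The entries of [B *m x] are the [x i 0 - p * r i], chosen in [S]. Multiplying by the adjugate
   then puts each [\det B * 'X^i] in [S]. *)
pose B : 'M[{poly K}]_n := 1%:M - p *: \matrix_(i, j) A i j.
have BS i j : B i j \in S.
  rewrite !mxE rpredB ?rpredM ?(AP i).1 //.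
  by case: (_ == _); rewrite ?rpred0 ?rpred1.
have BxS i : (B *m x) i 0 \in S.
  rewrite mulmxBl mul1mx -scalemxAl mxE [X in _ + X]mxE [X in - X]mxE.
  suff -> : (\matrix_(i, j) A i j *m x) i 0 = r i by apply: rS.
  by rewrite mxE (AP i).2; apply: eq_bigr => j _; rewrite !mxE.
have adjS i j : (\adj B) i j \in S.
  rewrite mxE /cofactor rpredMsign; apply: rpred_det => k l.
  by rewrite !mxE; have := BS (lift j k) (lift i l); rewrite !mxE.
have dxS (i : 'I_n) : \det B * 'X^i \in S.
  have -> : \det B * 'X^i = (\adj B *m (B *m x)) i 0.
    by rewrite mulmxA mul_adj_mx mul_scalar_mx !mxE.
  by rewrite mxE rpred_sum // => j _; rewrite rpredM.
exists (\det B) => [|q]; last first.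
  have [c cS ->] := poly_powers_span p1 pS q.
  by rewrite mulr_sumr rpred_sum // => i _; rewrite mulrCA rpredM.
(* [B] is the identity modulo any root of [p]. *)
have [z /rootP pz] : exists z, root p z.
  by apply/closed_rootP; rewrite neq_ltn p1 orbT.
apply/eqP => /(congr1 (horner_eval z)); rewrite rmorph0 -det_map_mx.
suff -> : map_mx (horner_eval z) B = 1%:M.
  by rewrite det1; apply/eqP; rewrite oner_eq0.
apply/matrixP => i j; rewrite !mxE /horner_eval !hornerE pz mul0r subr0.
by rewrite hornerMn hornerC.
Qed.

Hypothesis sepS : forall a b : K,
  exists w : {poly K}, ('X - b%:P) * (1 + ('X - a%:P) * w) \in S.

(** Multiply the elements given by [sepS a b] for [b] in [s]: every cofactor takes the value 1 at
    [a]. *)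
Lemma separating_product (a : K) (s : seq K) :
  exists2 v : {poly K}, v.[a] = 1 & \prod_(b <- s) ('X - b%:P) * v \in S.
Proof.
elim: s => [|b s [v va vS]].
  by exists 1; rewrite ?hornerC // big_nil mulr1 rpred1.
have [w wS] := sepS a b.
exists ((1 + ('X - a%:P) * w) * v).
  by rewrite !hornerE va subrr mul0r addr0 mul1r.
by rewrite big_cons mulrACA rpredM.
Qed.

Lemma separating_add_ideal (g : {poly K}) :
  g != 0 -> forall q, exists r, q - g * r \in S.
Proof.
have prodS (s : seq K) q : exists r, q - \prod_(b <- s) ('X - b%:P) * r \in S.
  elim: s q => [|a s IHs] q.
    by exists q; rewrite big_nil mul1r subrr rpred0.
  have [r rS] := IHs q; have [v va vS] := separating_product a s.
  rewrite big_cons; set h := \prod_(_ <- _) _ in rS vS *.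
  (* Subtracting a multiple of [v] makes [r] divisible by ['X - a%:P]; the correction to [q - h * r]
     stays in [S] because [h * v] does. *)
  have /factor_theorem[u uE] : root (r - r.[a]%:P * v) a.
    by rewrite /root !hornerE va mulr1 subrr.
  exists u.
  have -> : q - ('X - a%:P) * h * u = q - h * r + r.[a]%:P * (h * v).
    have -> : ('X - a%:P) * h * u = h * (u * ('X - a%:P)) by ring.
    by rewrite -uE; ring.
  by rewrite rpredD // rpredM.
move=> g0 q; have [s gE] := closed_field_poly_normal g.
have [r rS] := prodS s q; exists ((lead_coef g)^-1 *: r).
rewrite {1}gE -scalerAl -scalerAr scalerA divff ?scale1r //.
by rewrite lead_coef_eq0.
Qed.

Lemma separating_subring_full (q : {poly K}) : q \in S.
Proof.
(* With both points at 0 this gives an element of [S] whose coefficient at ['X] is 1, hence a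
   nonconstant one. *)
have [w wS] := sepS 0 0.
have [r rS] : exists r, 'X - 'X^2 * r \in S.
  exists (- w); move: wS; rewrite polyC0.
  by have -> : ('X - 0) * (1 + ('X - 0) * w) = 'X - 'X^2 * - w by ring.
set p := 'X - _ in rS.
have p1 : (1 < size p)%N.
  rewrite ltnNge; apply/negP => /leq_sizeP/(_ 1 isT)/eqP.
  by rewrite coefB coefX coefXnM subr0 oner_eq0.
have p0 : p != 0 by rewrite -size_poly_gt0 ltnW.
have [d d0 dS] := conductor_neq0 p1 rS (separating_add_ideal p0).
have [u uS] := separating_add_ideal d0 q.
by rewrite -[q](subrK (d * u)) rpredD.
Qed.

End Subalgebra.

Lemma maximal_subring_poly (K : closedFieldType) (S : subringClosed {poly K}) :
  maximal_subring S -> (forall a : K, a%:P \in S) ->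
  exists a b : K, S =i const_plus_ideal (('X - a%:P) * ('X - b%:P)).
Proof.
move=> [[x0 x0S] maxS] KS; apply: contrapT => noab; move/negP: x0S; apply.
apply: separating_subring_full => // a b; apply: contrapT => now.
(* If separation fails at [a], [b], then [S] lies in the proper subring K + fK[x], and maximality
   gives equality. *)
apply: noab; exists a, b => y; apply/esym; move: y.
pose f : {poly K} := ('X - a%:P) * ('X - b%:P).
apply: (maxS (const_plus_ideal f)).
  exists 'X; apply: polyX_notin_const_plus_ideal.
  by rewrite size_mul ?polyXsubC_eq0 // !size_XsubC.
move=> s sS.
have /factor_theorem[t tE] : root (s - s.[b]%:P) b.
  by rewrite /root !hornerE subrr.
have /factor_theorem[u uE] : root (t - t.[a]%:P) a.
  by rewrite /root !hornerE subrr.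
(* Newton expansion of [s] at the nodes [b], [a]. If the divided difference [t.[a]] is nonzero,
   dividing [s - s.[b]%:P] by it gives the separating element excluded by [now]. *)
have sE : s = s.[b]%:P + t.[a]%:P * ('X - b%:P) + f * u.
  rewrite -[LHS](subrK s.[b]%:P) tE -[t in LHS](subrK t.[a]%:P) uE /f; ring.
have [ta0|ta0] := eqVneq t.[a] 0.
  by apply/asboolP; exists s.[b], u; rewrite {1}sE ta0 mul0r addr0.
case: now; exists (t.[a]^-1%:P * u).
have -> : ('X - b%:P) * (1 + ('X - a%:P) * (t.[a]^-1%:P * u)) =
          t.[a]^-1%:P * (s - s.[b]%:P).
  rewrite {1}sE; transitivity ((t.[a]^-1%:P * t.[a]%:P) * ('X - b%:P)
     + t.[a]^-1%:P * (f * u)); last by ring.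
  rewrite -polyCM mulVf // /f; ring.
by rewrite rpredM // rpredB.
Qed.

Theorem theorem3p14 (K : closedFieldType) (S : subringClosed {poly K})
    (maxS : maximal_subring S) (KS : forall a : K, a%:P \in S) :
  ring_isomorphic (subring_of S)
    (subring_of (const_plus_ideal ('X * ('X - 1) : {poly K}))) \/
  ring_isomorphic (subring_of S)
    (subring_of (const_plus_ideal ('X^2 : {poly K}))).
Proof.
have [a [b SE]] := maximal_subring_poly maxS KS.
(* For a double root, translate it to 0; otherwise [(b - a) *: 'X + a%:P] takes 0 and 1 to [a] and
   [b]. *)
have [ab|ab] := eqVneq a b; [right | left].
  apply: (const_plus_ideal_affine (oner_neq0 K) SE (a := a)).
  rewrite -ab comp_polyM comp_polyB comp_polyX comp_polyC.
  by rewrite expr1n !scale1r addrK.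
have ba0 : b - a != 0 by rewrite subr_eq0 eq_sym.
apply: (const_plus_ideal_affine ba0 SE (a := a)).
rewrite comp_polyM !comp_polyB comp_polyX !comp_polyC -!mul_polyC.
rewrite expr2 polyCM polyCB; ring.
Qed.
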